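(* Let $\mathbb{F}$ be a field of characteristic different from $2$ and $G\leq\mathrm{GL}_n(\mathbb{F})$ a reflection group acting on $V=\mathbb{F}^n$. Suppose $\omega_1,\dots,\omega_n$ are $G$-invariant differential $1$-forms with $$\omega_1\wedge\cdots\wedge\omega_n = c\,Q(\tilde{\mathcal A})\,Q_{\det}\,dz_1\wedge\cdots\wedge dz_n$$ for some $c\in\mathbb{F}^\times$. Then $\omega_1,\dots,\omega_n$ is a basis of $(\Omega^1)^G$ as a free module over $\mathbb{F}[V]^G$: $(\Omega^1)^G=\bigoplus_i\mathbb{F}[V]^G\,\omega_i$.
   Context: $\mathbb{F}[V]=S(V^* )$; $z_1,\dots,z_n$ is a basis of $V^*$; $\Omega^1=\mathbb{F}[V]\otimes V^*$, with $G$ acting on $V^*$ by $(gf)(v)=f(g^{-1}v)$ and diagonally on forms; $(\Omega^1)^G$ is the set of invariant $1$-forms. A reflection is a finite-order element of $\mathrm{GL}(V)$ whose fixed space is a hyperplane; a reflection group is a finite group generated by reflections. For a hyperplane $H$ with defining linear form $l_H$, a reflection $s$ about $H$ satisfies $s(v)=v+l_H(v)\alpha_s$ (root vector $\alpha_s$); it is a transvection if $\alpha_s\in H$. $\mathcal A$ is the set of reflecting hyperplanes of reflections in $G$. For $H\in\mathcal A$: $G_H$ is the pointwise stabilizer of $H$ in $G$, $K_H=\ker(\det|_{G_H})$, $e_H=|G_H:K_H|$, and $b_H$ is the dimension of the span of the root vectors of transvections in $G_H$. Define $Q_{\det}=\prod_{H\in\mathcal A}l_H^{e_H-1}$ and $Q(\tilde{\mathcal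 A})=\prod_{H\in\mathcal A}l_H^{e_Hb_H}$. *)

(* Defs.v *)
From HB Require Import structures.
From mathcomp Require Import all_boot all_order all_algebra all_fingroup.
From mathcomp Require Import mxrepresentation.
From mathcomp Require Import mpoly.
Set Implicit Arguments. Unset Strict Implicit. Unset Printing Implicit Defensive.
Import GRing.Theory.
Local Open Scope ring_scope.

(* Conventions.  G <= GL_n(F) is given as a finite group G : {group gT}
   together with a FAITHFUL matrix representation rG : gT -> 'M[F]_n
   (so G is identified with its image rG @: G in GL_n(F)).
   V = F^n is the space of COLUMN vectors, g acting by v |-> rG g *m v.
   F[V] = {mpoly F[n]}, z_i = 'X_i (the i-th coordinate form).
   A 1-form  sum_j f_j dz_j  is its coefficient row vector 'rV_n of
   polynomials. *)

Section Defs.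
Variables (F : fieldType) (gT : finGroupType) (G : {group gT}) (n : nat).
Variable rG : mx_representation F G n.

(* (g f)(v) = f(g^-1 v): substitute z_j := sum_i (rG g^-1) j i z_i *)
Definition act_poly (g : gT) (p : {mpoly F[n]}) : {mpoly F[n]} :=
  comp_mpoly [tuple \sum_(i < n) ((rG g^-1)%g j i)%:MP * 'X_i | j < n] p.

(* diagonal action on 1-forms: g (f dz_j) = (g f) (g dz_j),
   g dz_j = sum_i (rG g^-1) j i dz_i *)
Definition act_form (g : gT) (w : 'rV[{mpoly F[n]}]_n) : 'rV[{mpoly F[n]}]_n :=
  \row_(i < n) \sum_(j < n) ((rG g^-1)%g j i)%:MP * act_poly g (w 0 j).

Definition inv_poly (p : {mpoly F[n]}) := forall g, g \in G -> act_poly g p = p.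
Definition inv_form (w : 'rV[{mpoly F[n]}]_n) :=
  forall g, g \in G -> act_form g w = w.

(* reflection: fixed space {v | rG g *m v = v} is a hyperplane *)
Definition is_reflection (g : gT) : bool := \rank (rG g - 1%:M) == 1%N.

(* fixed space, as a row space of transposed column vectors *)
Definition fixsp (g : gT) : 'M[F]_n := kermx ((rG g - 1%:M)^T).

(* the set A of reflecting hyperplanes (canonical row-space representatives) *)
Definition hyperplanes : seq 'M[F]_n :=
  undup [seq <<fixsp g>>%MS | g <- enum G & is_reflection g].

(* a defining linear form l_H of H: a nonzero column of cokermx H
   (whose column space is {c | H *m c = 0}) *)
Definition lform_vec (H : 'M[F]_n) : 'cV[F]_n :=
  match [pick j : 'I_n | col j (cokermx H) != 0] with
  | Some j => col j (cokermx H)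
  | None => 0
  end.
Definition lform (H : 'M[F]_n) : {mpoly F[n]} :=
  \sum_(i < n) (lform_vec H i 0)%:MP * 'X_i.

Definition GH (H : 'M[F]_n) : {set gT} :=
  [set g in G | H *m (rG g - 1%:M)^T == 0].
Definition KH (H : 'M[F]_n) : {set gT} :=
  [set g in GH H | \det (rG g) == 1].
Definition eH (H : 'M[F]_n) : nat := #|GH H : KH H|%g.

(* transvections in G_H : reflections whose root vector (spanning the
   column space of rG s - 1) lies in H; b_H = dim of span of root vectors *)
Definition is_transvection_in (H : 'M[F]_n) (s : gT) : bool :=
  [&& s \in GH H, is_reflection s & ((rG s - 1%:M)^T <= H)%MS].
Definition bH (H : 'M[F]_n) : nat :=
  \rank (\sum_(s in G | is_transvection_in H s) (rG s - 1%:M)^T)%MS.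

Definition Qdet : {mpoly F[n]} :=
  \prod_(H <- hyperplanes) lform H ^+ (eH H).-1.
Definition QtA : {mpoly F[n]} :=
  \prod_(H <- hyperplanes) lform H ^+ (eH H * bH H).

End Defs.

(* Main.v *)
(* By Cramer's rule D om = sum_i D_i w_i, where D is the determinant of the w_i
   and D_i the determinant obtained by replacing w_i with om, so it suffices that
   the determinant of any n invariant forms is divisible by
   prod_H l_H^(e_H b_H + e_H - 1).  The l_H are pairwise non-associate primes, so
   one hyperplane H at a time suffices.  Write s = 1 + a l_H for an s in G_H whose
   determinant has order e_H.  Contracting an invariant form with a root vector of
   a transvection in G_H gives an s-invariant polynomial divisible by l_H;
   contracting it with a gives an eigenvector of s.  As s acts on l_H by a scalar
   of order e_H, these contractions are divisible by l_H^(e_H) and l_H^(e_H - 1)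
   respectively. *)

Require Import Defs.
From HB Require Import structures.
From mathcomp Require Import all_boot all_order all_algebra all_fingroup.
From mathcomp Require Import mxrepresentation cyclic.
From mathcomp Require Import mpoly.
Import GRing.Theory.
Local Open Scope ring_scope.

Set Implicit Arguments.
Unset Strict Implicit.
Unset Printing Implicit Defensive.

(** * Divisibility in a commutative ring, entrywise for matrices *)

Section Divides.
Variable R : comNzRingType.
Implicit Types x y p q : R.

Definition divides x p := exists q, p = q * x.

Lemma divides0 x : divides x 0.
Proof. by exists 0; rewrite mul0r. Qed.

Lemma dividesD x p q : divides x p -> divides x q -> divides x (p + q).
Proof. by move=> [a ->] [b ->]; exists (a + b); rewrite mulrDl. Qed.

Lemma dividesMl x p q : divides x q -> divides x (p * q).
Proof. by move=> [a ->]; exists (p * a); rewrite mulrA. Qed.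

Lemma dividesMr x p q : divides x p -> divides x (p * q).
Proof. by rewrite mulrC; apply: dividesMl. Qed.

Lemma dividesN x p : divides x p -> divides x (- p).
Proof. by rewrite -mulN1r; apply: dividesMl. Qed.

Lemma divides_sum x (I : finType) (P : pred I) (f : I -> R) :
  (forall i, P i -> divides x (f i)) -> divides x (\sum_(i | P i) f i).
Proof.
by move=> H; apply: big_ind => //; [apply: divides0 | move=> p q; apply: dividesD].
Qed.

Definition divides_mx x m k (A : 'M[R]_(m, k)) := forall i j, divides x (A i j).

Lemma divides_mx_mulr x m k r (A : 'M[R]_(m, k)) (B : 'M_(k, r)) :
  divides_mx x A -> divides_mx x (A *m B).
Proof. by move=> xA i j; rewrite mxE; apply: divides_sum => s _; apply: dividesMr. Qed.

Lemma divides_mx_mull x m k r (A : 'M[R]_(m, k)) (B : 'M_(k, r)) :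
  divides_mx x B -> divides_mx x (A *m B).
Proof. by move=> xB i j; rewrite mxE; apply: divides_sum => s _; apply: dividesMl. Qed.

(** Multiplying by the adjugate turns [N *m v] into [\det N *: v]. *)
Lemma divides_det_mulmx x n (N : 'M[R]_n) (v : 'cV_n) k :
  divides_mx x (N *m v) -> divides x (\det N * v k 0).
Proof.
move=> xNv; have := divides_mx_mull (\adj N) xNv.
by rewrite mulmxA mul_adj_mx mul_scalar_mx => /(_ k 0); rewrite mxE.
Qed.

Lemma divides_colP n (N : 'M[R]_n) (d : 'rV[R]_n) :
  (forall k, divides_mx (d 0 k) (col k N)) -> exists N', N = N' *m diag_mx d.
Proof.
move=> dN.
have /fin_all_exists[f Hf] : forall ij : 'I_n * 'I_n,
    exists q, N ij.1 ij.2 = q * d 0 ij.2.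
  by case=> i k; have [q] := dN k i 0; rewrite mxE => Hq; exists q.
exists (\matrix_(i, k) f (i, k)); apply/matrixP=> i k.
by rewrite mul_mx_diag !mxE (Hf (i, k)).
Qed.

(** [A] and a unipotent block matrix are multiplied in both orders, and the two determinants agree.
    This computes the determinant of an element of [G_H] from its root vector. *)
Lemma det_1D_col_row n (a c : 'cV[R]_n) :
  \det (1%:M + a *m c^T) = 1 + (c^T *m a) 0 0.
Proof.
pose A := block_mx (1%:M : 'M[R]_n) (- a) c^T (1%:M : 'M_1).
have E1 : A *m block_mx 1%:M a 0 1%:M = block_mx 1%:M 0 c^T (1%:M + c^T *m a).
  rewrite mulmx_block !mulmx1 !mul1mx !mulmx0 !addr0 subrr.
  by rewrite [X in block_mx _ _ _ X]addrC.
have E2 : block_mx 1%:M a 0 1%:M *m A = block_mx (1%:M + a *m c^T) 0 c^T 1%:M.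
  by rewrite mulmx_block !mulmx1 !mul1mx !mul0mx !add0r addrC addNr.
have: \det (block_mx 1%:M a 0 1%:M *m A) = \det (A *m block_mx 1%:M a 0 1%:M).
  by rewrite !det_mulmx mulrC.
by rewrite E1 E2 !det_lblock !det1 mulr1 mul1r det_mx11 !mxE eqxx.
Qed.

End Divides.

(** * Linear forms as primes of the polynomial ring *)

Section LinearForm.
Variables (F : fieldType) (n : nat).
Local Notation R := {mpoly F[n]}.
Implicit Types c d : 'cV[F]_n.

(** At [c := lform_vec H] this unfolds to the same sum as [lform H]. *)
Definition linform c : R := \sum_(i < n) (c i 0)%:MP * 'X_i.

Lemma linformZ a c : linform (a *: c) = a%:MP * linform c.
Proof.
by rewrite /linform mulr_sumr; apply: eq_bigr => i _; rewrite mxE mpolyCM mulrA.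
Qed.

Lemma mcoeff_linform c k : (linform c)@_U_(k) = c k 0.
Proof.
rewrite /linform raddf_sum (bigD1 k) //= mcoeffCM mcoeffX eqxx mulr1 big1 ?addr0 //.
move=> i ik; rewrite mcoeffCM mcoeffX; case: eqP => [/eqP|]; last by rewrite mulr0.
by rewrite eq_mnm1 (negPf ik).
Qed.

Lemma linform_inj : injective linform.
Proof. by move=> c d E; apply/colP=> k; rewrite -!mcoeff_linform E. Qed.

Lemma linform_eq0 c : (linform c == 0) = (c == 0).
Proof.
rewrite -(inj_eq linform_inj); congr (_ == _).
by rewrite /linform big1 // => i _; rewrite mxE mpolyC0 mul0r.
Qed.

Lemma comp_mpoly_linform (t : n.-tuple R) c :
  linform c \mPo t = \sum_i (c i 0)%:MP * tnth t i.
Proof.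
rewrite /linform raddf_sum; apply: eq_bigr => i _.
by rewrite /= rmorphM /= comp_mpolyC comp_mpolyXU -tnth_nth.
Qed.

(** The polynomials fixed modulo [x] by the substitution are closed under linear combinations and,
    by [stab], under products, so the variables decide. *)
Lemma comp_mpoly_sub_divides (x : R) (t : n.-tuple R) p :
  (forall i, divides x (tnth t i - 'X_i)) -> divides x (p \mPo t - p).
Proof.
move=> xt.
have stab q r : divides x (q \mPo t - q) -> divides x (r \mPo t - r) ->
    divides x ((q * r) \mPo t - q * r).
  move=> xq xr; rewrite rmorphM /=.
  have -> : (q \mPo t) * (r \mPo t) - q * r
      = (q \mPo t - q) * (r \mPo t) + q * (r \mPo t - r).
    by rewrite mulrBl mulrBr addrA subrK.
  by apply: dividesD; [apply: dividesMr | apply: dividesMl].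
elim/mpolyind: p => [|a m p _ _ IHp].
  by rewrite rmorph0 subr0; apply: divides0.
have -> : (a *: 'X_[m] + p) \mPo t - (a *: 'X_[m] + p)
    = a%:MP * ('X_[m] \mPo t - 'X_[m]) + (p \mPo t - p).
  by rewrite mul_mpolyC rmorphD /= linearZ /= scalerBr opprD addrACA.
apply: dividesD IHp; apply: dividesMl; rewrite mpolyXE_id.
apply: (big_ind (fun q => divides x (q \mPo t - q))) => [|q r|i _].
- by rewrite rmorph1 subrr; apply: divides0.
- exact: stab.
elim: (m i) => [|k IHk]; first by rewrite expr0 rmorph1 subrr; apply: divides0.
by rewrite exprS; apply: stab => //; rewrite comp_mpolyXU -tnth_nth.
Qed.

Section Prime.
Variable c : 'cV[F]_n.
Hypothesis c_neq0 : c != 0.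
Let l := linform c.

Lemma comp_mpoly_linform_shift (u : 'I_n -> F) d :
  linform d \mPo [tuple 'X_i - (u i)%:MP * l | i < n]
    = linform d - (\sum_i d i 0 * u i)%:MP * l.
Proof.
rewrite comp_mpoly_linform.
under eq_bigr => i _ do rewrite tnth_mktuple mulrBr mulrA -mpolyCM.
by rewrite sumrB -mulr_suml raddf_sum.
Qed.

(* With u c = 1, the endomorphism p(v) |-> p(v - l(v) u) of F[V] has kernel (l). *)
Lemma linform_retraction : exists u : 'I_n -> F,
  forall p, divides l p <-> p \mPo [tuple 'X_i - (u i)%:MP * l | i < n] = 0.
Proof.
have [j cj] : exists j, c j 0 != 0.
  apply/existsP; apply: contraNT c_neq0 => /existsPn c0.
  by apply/eqP/colP=> j; rewrite mxE; apply/eqP; move: (c0 j); rewrite negbK.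
pose u i : F := if i == j then (c j 0)^-1 else 0.
exists u => p; split=> [[q ->]|p0].
  rewrite rmorphM /= comp_mpoly_linform_shift (bigD1 j) //= big1 => [|i /negPf ij].
    by rewrite /u eqxx divff // addr0 mul1r subrr mulr0.
  by rewrite /u ij mulr0.
rewrite -[p]opprK -[- p]add0r -p0; apply: dividesN.
apply: comp_mpoly_sub_divides => i; rewrite tnth_mktuple addrAC subrr add0r.
by apply: dividesN; exists (u i)%:MP.
Qed.

(** [l] generates the kernel of an endomorphism of an integral domain. *)
Lemma linform_prime p q : divides l (p * q) -> divides l p \/ divides l q.
Proof.
have [t tP] := linform_retraction; rewrite !tP rmorphM /= => /eqP.
by rewrite mulf_eq0 => /orP[/eqP|/eqP]; [left | right].
Qed.

Lemma linform_not_dividesC (a : F) : a != 0 -> ~ divides l a%:MP.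
Proof.
have [t tP] := linform_retraction.
by move=> a0; rewrite tP comp_mpolyC => /eqP; rewrite mpolyC_eq0 (negPf a0).
Qed.

(** Primality puts one factor [l] into [p]; cancel it and induct on [k]. *)
Lemma linform_pow_coprime k p q :
  ~ divides l q -> divides (l ^+ k) (p * q) -> divides (l ^+ k) p.
Proof.
have l0 : l != 0 by rewrite linform_eq0.
move=> lq; elim: k p => [|k IHk] p; first by move=> _; exists p; rewrite expr0 mulr1.
move=> [r E]; have [[p' Ep]|//] : divides l p \/ divides l q.
  by apply: linform_prime; exists (r * l ^+ k); rewrite E exprSr mulrA.
have [|r' Er'] := IHk p'.
  exists r; apply: (mulIf l0).
  by rewrite mulrAC -Ep E exprSr mulrA.
by exists r'; rewrite Ep Er' exprSr mulrA.
Qed.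

Lemma divides_linform d : divides l (linform d) -> exists a, d = a *: c.
Proof.
have [u uP] := linform_retraction.
rewrite uP comp_mpoly_linform_shift => /eqP; rewrite subr_eq0 -linformZ => /eqP.
by move/linform_inj=> ->; exists (\sum_i d i 0 * u i).
Qed.

Lemma linform_divides_prod (I : eqType) (s : seq I) (f : I -> R) :
  divides l (\prod_(i <- s) f i) -> exists2 i, i \in s & divides l (f i).
Proof.
elim: s => [|i s IHs].
  by rewrite big_nil -mpolyC1 => /linform_not_dividesC[]; apply: oner_neq0.
rewrite big_cons => /linform_prime[li|/IHs[j js lj]]; first by exists i; rewrite ?mem_head.
by exists j; rewrite // inE js orbT.
Qed.

Lemma linform_divides_exp k p : divides l (p ^+ k) -> divides l p.
Proof.
by rewrite -[k]card_ord -prodr_const -big_enum => /linform_divides_prod[].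
Qed.

(** Let [p = q * l ^+ k]. Applying [phi] and cancelling [l ^+ k] gives [z ^+ k * phi q = y * q].
    Since [phi q] and [q] agree modulo [l], [l] divides [(y - z ^+ k) * q], hence [q] as soon as
    [y != z ^+ k]. Each admissible exponent thus gains one factor. *)
Lemma divides_pow_eigen (phi : {rmorphism R -> R}) (y z : F) p a m :
  (forall q, divides l (phi q - q)) -> phi l = z%:MP * l -> phi p = y%:MP * p ->
  divides (l ^+ a) p -> (forall i, (a <= i < a + m)%N -> y != z ^+ i) ->
  divides (l ^+ (a + m)) p.
Proof.
move=> phi_id phi_l phi_p la; elim: m => [|m IHm] yz; first by rewrite addn0.
have [|q Eq] := IHm; first by move=> i /andP[ai im]; rewrite yz // ai addnS ltnW.
have [r Er] := phi_id q.
have nz : y - z ^+ (a + m) != 0 by rewrite subr_eq0 yz // leq_addr addnS /=.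
have l0 : l ^+ (a + m) != 0 by rewrite expf_neq0 // linform_eq0.
have E : (z ^+ (a + m))%:MP * phi q = y%:MP * q.
  apply: (mulIf l0); rewrite -[RHS]mulrA -Eq -phi_p Eq rmorphM !rmorphXn /= phi_l.
  by rewrite exprMn [X in X * _ = _]mulrC mulrA.
have Eq' : (y - z ^+ (a + m))%:MP * q = (z ^+ (a + m))%:MP * r * l.
  by rewrite mpolyCB mulrBl -E -mulrBr Er mulrA.
exists ((y - z ^+ (a + m))^-1%:MP * ((z ^+ (a + m))%:MP * r)).
rewrite addnS exprS mulrA -[_ * _ * l]mulrA -Eq' mulrA -mpolyCM.
by rewrite mulVf // mpolyC1 mul1r.
Qed.

End Prime.

(** By primality the first form cannot divide the product of the others, so its full power divides
    the remaining cofactor of [p]. *)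
Lemma divides_prod_linform (I : eqType) (s : seq I) (c : I -> 'cV[F]_n)
    (m : I -> nat) p :
  uniq s -> {in s, forall i, c i != 0} ->
  {in s &, forall i j, divides (linform (c i)) (linform (c j)) -> i = j} ->
  {in s, forall i, divides (linform (c i) ^+ m i) p} ->
  divides (\prod_(i <- s) linform (c i) ^+ m i) p.
Proof.
elim: s => [|i s IHs] /=; first by exists p; rewrite big_nil mulr1.
case/andP=> i_s us c0 inj dvd; rewrite big_cons.
have sub j : j \in s -> j \in i :: s by rewrite inE orbC => ->.
have [r Er] : divides (\prod_(j <- s) linform (c j) ^+ m j) p.
  by apply: IHs => // [j /sub /c0 | j k /sub sj /sub sk | j /sub /dvd] //; apply: inj.
have ci : c i != 0 by apply: c0; rewrite mem_head.
have [||r' Er'] := @linform_pow_coprime _ ci (m i) r (\prod_(j <- s) linform (c j) ^+ m j).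
- case/(linform_divides_prod ci)=> j sj /(linform_divides_exp ci) /inj Eij.
  by move: i_s; rewrite Eij ?sj ?mem_head ?sub.
- by rewrite -Er; apply: dvd; rewrite mem_head.
by exists r'; rewrite Er Er' mulrA.
Qed.
End LinearForm.

(** * The group action and the reflecting hyperplanes *)

Section Reflections.
Variables (F : fieldType) (gT : finGroupType) (G : {group gT}) (n : nat).
Variable rG : mx_representation F G n.
Local Notation R := {mpoly F[n]}.
Local Notation C := (map_mx (@mpolyC n F)).
Implicit Types (g : gT) (H : 'M[F]_n).

(** [act_form] is the coefficientwise action followed by right multiplication by [rG g^-1];
    invariance lets that factor change sides. *)
Lemma inv_form_map g (w : 'rV[R]_n) : g \in G ->
  act_form rG g w = w -> map_mx (act_poly rG g) w = w *m C (rG g).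
Proof.
move=> gG Ew.
have E : act_form rG g w = map_mx (act_poly rG g) w *m C (rG g^-1%g).
  by apply/rowP=> i; rewrite !mxE; apply: eq_bigr => j _; rewrite !mxE mulrC.
rewrite -{2}Ew E -mulmxA -map_mxM repr_mxV // mulVmx ?repr_mx_unit //.
by rewrite map_mx1 mulmx1.
Qed.

(** The substitution sends ['X_j] to ['X_j] plus [a j 0] times [linform c]. *)
Lemma act_poly_sub_divides g (a c : 'cV[F]_n) p :
  rG g^-1%g = 1%:M + a *m c^T -> divides (linform c) (act_poly rG g p - p).
Proof.
move=> Eg; apply: comp_mpoly_sub_divides => j; rewrite tnth_mktuple Eg.
exists (a j 0)%:MP; rewrite mulr_sumr -[X in _ - X]mul1r.
have -> : 1 * 'X_j = \sum_i (i == j)%:R%:MP * 'X_i :> R.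
  by rewrite (bigD1 j) //= eqxx mpolyC1 big1 ?addr0 // => i /negPf->; rewrite mpolyC0 mul0r.
rewrite -sumrB; apply: eq_bigr => i _.
by rewrite -mulrBl -mpolyCB !mxE big_ord1 !mxE eq_sym addrAC subrr add0r mulrA -mpolyCM.
Qed.

(** [c^T] is a left eigenvector of [1%:M + a *m c^T], and its eigenvalue [1 + c^T a] is the
    determinant. *)
Lemma act_poly_linform g (a c : 'cV[F]_n) :
  rG g^-1%g = 1%:M + a *m c^T ->
  act_poly rG g (linform c) = (\det (rG g^-1%g))%:MP * linform c.
Proof.
move=> Eg; rewrite /act_poly comp_mpoly_linform.
under eq_bigr => j _ do rewrite tnth_mktuple mulr_sumr.
rewrite exchange_big /= -linformZ; apply: eq_bigr => i _.
under eq_bigr => j _ do rewrite mulrA -mpolyCM.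
rewrite -mulr_suml -raddf_sum; congr (_%:MP * _) => /=.
have -> : \sum_j c j 0 * rG g^-1%g j i = (c^T *m rG g^-1%g) 0 i.
  by rewrite mxE; apply: eq_bigr => j _; rewrite mxE.
rewrite Eg det_1D_col_row mulmxDr mulmx1 mulmxA [c^T *m a]mx11_scalar mul_scalar_mx.
by rewrite -{1}[c^T]scale1r -scalerDl !mxE.
Qed.

Lemma rank_hyperplane H : H \in hyperplanes rG -> (\rank H).+1 = n /\ H = <<H>>%MS.
Proof.
rewrite mem_undup => /mapP[g]; rewrite mem_filter => /andP[/eqP rg _] ->.
split; last by rewrite genmx_id.
rewrite genmxE mxrank_ker mxrank_tr rg subn1 prednK //.
by rewrite -rg; apply: rank_leq_row.
Qed.

Lemma lform_vecP H : H \in hyperplanes rG -> lform_vec H != 0 /\ H *m lform_vec H = 0.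
Proof.
case/rank_hyperplane=> rH _; rewrite /lform_vec; case: pickP => [j cj|c0].
  by split=> //; rewrite colE mulmxA mulmx_coker mul0mx.
have: \rank (cokermx H) = 1%N by rewrite mxrank_coker -[X in (X - _)%N]rH subSnn.
suff -> : cokermx H = 0 by rewrite mxrank0.
by apply/matrixP=> i j; have /negbFE/eqP/colP/(_ i) := c0 j; rewrite !mxE.
Qed.

(** Dimensions turn the inclusion into equality of spaces, and canonical representatives turn that
    into equality of matrices. Thus a linear form determines its hyperplane. *)
Lemma hyperplane_eq H (d : 'cV[F]_n) :
  H \in hyperplanes rG -> d != 0 -> H *m d = 0 -> H = <<kermx d>>%MS.
Proof.
case/rank_hyperplane=> rH EH d0 Hd; rewrite [LHS]EH; apply/genmxP.
have HK : (H <= kermx d)%MS by apply/sub_kermxP.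
rewrite -(geq_leqif (mxrank_leqif_eq HK)) mxrank_ker leq_subLR.
apply: (@leq_trans (\rank H).+1); first by rewrite rH.
by rewrite -add1n leq_add2r lt0n mxrank_eq0.
Qed.

(** The rows of [A] lie in the annihilator of [H], a line spanned by [(lform_vec H)^T]. *)
Lemma vanish_hyperplane H (A : 'M[F]_n) :
  H \in hyperplanes rG -> H *m A^T = 0 -> exists a, A = a *m (lform_vec H)^T.
Proof.
move=> hH HA; have [c0 Hc] := lform_vecP hH; have [rH _] := rank_hyperplane hH.
apply/submxP.
have cK : ((lform_vec H)^T <= kermx H^T)%MS.
  by apply/sub_kermxP; rewrite -trmx_mul Hc trmx0.
apply: (@submx_trans _ _ _ _ _ _ (kermx H^T)).
  by apply/sub_kermxP; rewrite -[A]trmxK -trmx_mul HA trmx0.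
rewrite -(geq_leqif (mxrank_leqif_sup cK)) mxrank_ker !mxrank_tr leq_subLR addnC.
apply: (@leq_trans (\rank H).+1); first by rewrite rH.
by rewrite -add1n leq_add2r lt0n mxrank_eq0.
Qed.

(** * The groups [G_H] and [K_H], and the determinant on their quotient *)

Lemma GH_group_set H : group_set (GH rG H).
Proof.
apply/group_setP; split=> [|x y].
  by rewrite inE group1 repr_mx1 subrr trmx0 mulmx0 eqxx.
rewrite !inE => /andP[xG /eqP Hx] /andP[yG /eqP Hy]; rewrite groupM //= repr_mxM //.
have -> : rG x *m rG y - 1%:M = rG x *m (rG y - 1%:M) + (rG x - 1%:M).
  by rewrite mulmxBr mulmx1 addrA subrK.
by rewrite linearD /= mulmxDr Hx trmx_mul mulmxA Hy mul0mx addr0.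
Qed.
Canonical GH_group H := Group (GH_group_set H).

Lemma GH_sub H : GH rG H \subset G.
Proof. by apply/subsetP=> x; rewrite inE => /andP[]. Qed.

Lemma det_repr_mxM x y : x \in G -> y \in G ->
  \det (rG (x * y)%g) = \det (rG x) * \det (rG y).
Proof. by move=> xG yG; rewrite repr_mxM // det_mulmx. Qed.

Lemma mem_KH H x : (x \in KH rG H) = (x \in GH rG H) && (\det (rG x) == 1).
Proof. by rewrite inE. Qed.

Lemma KH_group_set H : group_set (KH rG H).
Proof.
have sG := subsetP (GH_sub H).
apply/group_setP; split=> [|x y].
  by rewrite mem_KH (group1 (GH_group H)) repr_mx1 det1 eqxx.
rewrite !mem_KH => /andP[xH /eqP dx] /andP[yH /eqP dy].
rewrite (groupM (xH : x \in GH_group H) yH) det_repr_mxM ?sG //.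
by rewrite dx dy mulr1 eqxx.
Qed.
Canonical KH_group H := Group (KH_group_set H).

Lemma KH_norm H : GH_group H \subset 'N(KH_group H)%g.
Proof.
have sG := subsetP (GH_sub H).
apply/subsetP=> x xH; rewrite inE; apply/subsetP=> _ /imsetP[y yK ->].
move: yK; rewrite !mem_KH => /andP[yH /eqP dy]; rewrite /conjg.
have xVH : (x^-1)%g \in GH_group H by rewrite groupV.
rewrite !groupM //=; have [xG xVG yG] := And3 (sG _ xH) (sG _ xVH) (sG _ yH).
rewrite !det_repr_mxM ?groupM // dy mul1r -det_repr_mxM //.
by rewrite mulVg repr_mx1 det1 eqxx.
Qed.

(* G_H / K_H embeds in the multiplicative group of F via det, so it is cyclic. *)
Lemma GH_det_generator H : exists2 s, s \in GH rG H &
  forall i, (0 < i < eH rG H)%N -> \det (rG s) ^+ i != 1.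
Proof.
have sG := subsetP (GH_sub H); have nK := subsetP (KH_norm H).
pose K := KH_group H.
(* The choice of representative is harmless because elements of [K] have determinant 1. *)
pose f (xb : coset_of K) := \det (rG (repr xb)).
have fE x : x \in GH_group H -> f (coset K x) = \det (rG x).
  move=> xH; have /rcosetP[k kK Ek] : repr (coset K x) \in (K :* x)%g.
    by rewrite -val_coset ?nK // mem_repr_coset.
  rewrite /f Ek.
  move: kK; rewrite mem_KH => /andP[kH /eqP dk].
  by rewrite det_repr_mxM ?sG // dk mul1r.
have fX x i : x \in GH_group H -> f (coset K x ^+ i)%g = \det (rG x) ^+ i.
  move=> xH; rewrite -morphX ?nK // fE ?groupX //.
  elim: i => [|i IHi]; first by rewrite repr_mx1 det1.
  by rewrite expgS det_repr_mxM ?sG ?groupX // IHi exprS.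
have f1 x : x \in GH_group H -> f (coset K x) = 1 -> coset K x = 1%g.
  by move=> xH; rewrite fE // => dx; apply: coset_id; rewrite mem_KH xH dx eqxx.
have: cyclic (GH_group H / K)%g.
  apply: (@field_mul_group_cyclic _ _ _ f).
    move=> _ _ /morphimP[x xN xH ->] /morphimP[y yN yH ->].
    by rewrite -morphM // !fE ?groupM // det_repr_mxM ?sG.
  move=> _ /morphimP[x xN xH ->]; split=> [|E]; first exact: f1.
  by rewrite E -(morph1 (coset_morphism K)) fE ?group1 // repr_mx1 det1.
case/cyclicP=> xb Exb.
have : xb \in (GH_group H / K)%g by rewrite Exb cycle_id.
(* If [\det (rG s) ^+ i] were 1, the order [eH rG H] of the generator [xb] would divide [i]. *)
case/morphimP=> s sN sH Es; exists s => // i /andP[i0 ie]; apply: contraL ie => /eqP ds.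
rewrite -leqNgt dvdn_leq //.
have -> : eH rG H = #[xb]%g by rewrite orderE -Exb card_quotient ?KH_norm.
rewrite order_dvdn; apply/eqP; rewrite Es -morphX //.
by apply: f1; rewrite ?groupX // morphX // fX.
Qed.

(** * Matrices whose rows are invariant forms *)

Definition equivariant_mx (M : 'M[R]_n) :=
  forall g, g \in G -> map_mx (act_poly rG g) M = M *m C (rG g).

Lemma map_act_const g m k (A : 'M[F]_(m, k)) : map_mx (act_poly rG g) (C A) = C A.
Proof. by apply/matrixP=> i j; rewrite !mxE; apply: comp_mpolyC. Qed.

Lemma map_act_mulmx g m k r (A : 'M[R]_(m, k)) (B : 'M_(k, r)) :
  map_mx (act_poly rG g) (A *m B) = map_mx (act_poly rG g) A *m map_mx (act_poly rG g) B.
Proof. exact: (map_mxM (comp_mpoly _)). Qed.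

Lemma inv_forms_equivariant (v : 'I_n -> 'rV[R]_n) :
  (forall i, inv_form rG (v i)) -> equivariant_mx (\matrix_(i, j) v i 0 j).
Proof.
move=> inv_v g gG; apply/matrixP=> i j; have /rowP/(_ j) := inv_form_map gG (inv_v i g gG).
by rewrite !mxE => ->; apply: eq_bigr => k _; rewrite !mxE.
Qed.

Lemma divides_mulC (x p : R) (a : F) : a != 0 -> divides x (p * a%:MP) -> divides x p.
Proof.
move=> a0 /(dividesMr a^-1%:MP).
by rewrite -mulrA -mpolyCM divff // mpolyC1 mulr1.
Qed.

(** * Divisibility by powers of a single [l_H] *)

Section AlongHyperplane.
Variables (H : 'M[F]_n) (M : 'M[R]_n).
Hypotheses (hH : H \in hyperplanes rG) (eqM : equivariant_mx M).
Let l := lform H.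
Let e := eH rG H.
Let b := bH rG H.
Let T := (\sum_(s in G | is_transvection_in rG H s) (rG s - 1%:M)^T)%MS.

Lemma GH_root g : g \in GH rG H -> exists a, rG g = 1%:M + a *m (lform_vec H)^T.
Proof.
rewrite inE => /andP[_ /eqP Hg]; have [a Ea] := vanish_hyperplane hH Hg.
by exists a; rewrite -Ea addrC subrK.
Qed.

Lemma act_sub_divides_GH g p : g \in GH rG H -> divides l (act_poly rG g p - p).
Proof.
rewrite -(groupV (GH_group H)) => /GH_root[a Ea].
exact: act_poly_sub_divides Ea.
Qed.

(** Equivariance turns [M *m C (rG s - 1%:M)] into the change of [M] under [s], which [l] divides;
    such columns span the space encoded by [T]. *)
Lemma divides_mx_transvections m (B : 'M[F]_(m, n)) :
  (B <= T)%MS -> divides_mx l (M *m C B^T).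
Proof.
case/sub_sumsmxP=> u ->; rewrite linear_sum /= raddf_sum mulmx_sumr /= => i j.
rewrite summxE; apply: divides_sum => s /andP[sG /and3P[sH _ _]].
rewrite trmx_mul trmxK map_mxM mulmxA.
apply: divides_mx_mulr => {}i {}j; rewrite map_mxB mulmxBr -eqM // map_mx1 mulmx1 !mxE.
exact: act_sub_divides_GH.
Qed.

Lemma transvections_sub : (T <= H)%MS.
Proof. by apply/sumsmx_subP=> s /andP[_ /and3P[]]. Qed.

(** Under [g] the entries of [M *m C A] are scaled by [y] and [l] by [\det (rG g^-1)], so
    [divides_pow_eigen] applies entrywise. *)
Lemma divides_mx_eigen g m (A : 'M[F]_(n, m)) (y : F) k r :
  g \in GH rG H -> rG g *m A = y *: A -> divides_mx (l ^+ k) (M *m C A) ->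
  (forall i, (k <= i < k + r)%N -> y != \det (rG g^-1%g) ^+ i) ->
  divides_mx (l ^+ (k + r)) (M *m C A).
Proof.
move=> gH gA lA yz i j; have [c0 _] := lform_vecP hH.
have gG := subsetP (GH_sub H) _ gH.
apply: (@divides_pow_eigen _ _ _ c0 (act_poly rG g) y _ _ _ _ _ _ _ (lA i j) yz).
- by move=> q; apply: act_sub_divides_GH.
- have [|a Ea] := @GH_root g^-1%g; first by rewrite (groupV (GH_group H)).
  exact: act_poly_linform Ea.
have : map_mx (act_poly rG g) (M *m C A) = y%:MP *: (M *m C A).
  by rewrite map_act_mulmx map_act_const eqM // -mulmxA -map_mxM gA map_mxZ scalemxAr.
by move/matrixP/(_ i j); rewrite !mxE.
Qed.

Lemma eH_gt0 : (0 < e)%N.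
Proof. exact: (indexg_gt0 (GH_group H)). Qed.

(** Vectors of [T] lie in [H], so [s^-1] fixes them and the contractions have eigenvalue 1. Exponent
    1 is already available, and [\det (rG s) ^+ i != 1] for [0 < i < e] raises it to [e]. *)
Lemma divides_mx_pow_transvections m (B : 'M[F]_(m, n)) :
  (B <= T)%MS -> divides_mx (l ^+ e) (M *m C B^T).
Proof.
move=> BT; have [s sH zs] := GH_det_generator H.
have sVH : (s^-1)%g \in GH rG H by rewrite (groupV (GH_group H)).
rewrite -(prednK eH_gt0) -add1n.
apply: (@divides_mx_eigen _ _ _ 1 _ _ sVH).
- move: sVH; rewrite inE => /andP[_ /eqP Hs].
  have /submxP[D ->] := submx_trans BT transvections_sub.
  rewrite scale1r trmx_mul; apply/eqP; rewrite -subr_eq0 mulmxA.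
  by rewrite -mulmxBl -{2}[H^T]mul1mx -mulmxBl -[_ - _]trmxK -trmx_mul Hs trmx0 mul0mx.
- by rewrite expr1; apply: divides_mx_transvections.
move=> i ie; rewrite invgK eq_sym zs //.
by move: ie; rewrite add1n prednK ?eH_gt0.
Qed.

(* The column M a transforms under s^-1 by det(s)^-1, whereas l transforms by det(s). *)
Lemma divides_mx_pow_root : exists2 a : 'cV[F]_n,
  divides_mx (l ^+ e.-1) (M *m C a) & (1 < e)%N -> ~~ (a^T <= T)%MS.
Proof.
have [s sH zs] := GH_det_generator H; have [a Ea] := GH_root sH.
have sVH : (s^-1)%g \in GH rG H by rewrite (groupV (GH_group H)).
have sG := subsetP (GH_sub H) _ sH.
have Ez : \det (rG s) = 1 + ((lform_vec H)^T *m a) 0 0 by rewrite Ea det_1D_col_row.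
have z0 : \det (rG s) != 0 by rewrite -unitfE -unitmxE repr_mx_unit.
exists a.
  rewrite -[e.-1]add0n; apply: (@divides_mx_eigen _ _ _ (\det (rG s))^-1 _ _ sVH).
  - have sa : rG s *m a = \det (rG s) *: a.
      rewrite Ez Ea mulmxDl mul1mx -mulmxA [_^T *m a]mx11_scalar mul_mx_scalar.
      by rewrite scalerDl scale1r !mxE.
    rewrite -{1}[a](scalerK z0) -sa repr_mxV // -scalemxAr mulmxA.
    by rewrite mulVmx ?repr_mx_unit // mul1mx.
  - by move=> i j; exists ((M *m C a) i j); rewrite expr0 mulr1.
  (* Equality of [(\det (rG s))^-1] with the [i]-th power would make the power [i.+1 < e] equal to
     1. *)
  move=> i /= ie; rewrite invgK; apply: contra_neqN (zs i.+1 _) => [/eqP Ei|].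
    by rewrite exprS -Ei divff.
  by move: ie; rewrite add0n -ltnS prednK ?eH_gt0.
(* If [a] were in [T], hence in [H], then [l] would vanish at [a] and [\det (rG s)] would be 1. *)
move=> e1; apply: contra_neqN (zs 1%N e1) => aT.
have /submxP[D Ed] := submx_trans aT transvections_sub.
have [_ Hc] := lform_vecP hH.
rewrite expr1 Ez -[_ *m a]trmxK trmx_mul trmxK Ed -mulmxA Hc mulmx0.
by rewrite !mxE addr0.
Qed.

(** In a basis whose first [b] vectors span [T], each of the first [b] columns yields [l ^+ e]. The
    last factor comes from the root [a]: outside [T] it has a nonzero constant coordinate at some
    [k >= b], where [d] is 1. *)
Lemma divides_det_equivariant : divides (l ^+ (e * b + e.-1)) (\det M).
Proof.
(* By the rank factorization of [T], the first [b] rows of [U] span it. *)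
pose U := row_ebase T; have Uu : U \in unitmx := row_ebase_unit T.
have bn : (b <= n)%N := rank_leq_row T.
pose d : 'rV[R]_n := \row_k (if (k < b)%N then l ^+ e else 1).
have UT : ((pid_mx b : 'M[F]_n) *m U <= T)%MS.
  have -> : pid_mx b *m U = invmx (col_ebase T) *m T; last exact: submxMl.
  rewrite -[X in _ = _ *m X](mulmx_ebase T) !mulmxA.
  by rewrite mulVmx ?col_ebase_unit // mul1mx.
have [|N' EN] := @divides_colP _ _ (M *m C U^T) d.
  move=> k; rewrite mxE.
  case: ltnP => kb; last by move=> i j; exists ((col k (M *m C U^T)) i j); rewrite mulr1.
  have -> : col k (M *m C U^T) = M *m C (row k U)^T.
    by rewrite !colE -mulmxA tr_row colE map_mxM map_delta_mx.
  apply: divides_mx_pow_transvections.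
  have Ek : row k (pid_mx b : 'M[F]_n) = delta_mx 0 k.
    by apply/rowP=> j; rewrite !mxE kb andbT eq_sym.
  by rewrite rowE -Ek -row_mul; apply: submx_trans (row_sub _ _) UT.
have detN : \det M * (\det U)%:MP = \det N' * l ^+ (e * b).
  rewrite -[\det U]det_tr -det_map_mx -det_mulmx EN det_mulmx det_diag; congr (_ * _).
  under eq_bigr => k _ do rewrite mxE.
  by rewrite -big_mkcond (big_ord_narrow bn) prodr_const card_ord exprM.
have dU : \det U != 0 by rewrite -unitfE -unitmxE.
apply: (divides_mulC dU); rewrite detN.
suff [q ->] : divides (l ^+ e.-1) (\det N').
  by exists q; rewrite exprD -mulrA [l ^+ e.-1 * _]mulrC.
(* For [e = 1] the exponent [e.-1] is 0; only for [e > 1] is [a] known to lie outside [T]. *)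
have [e1|] := ltnP 1 e; last first.
  rewrite leq_eqVlt ltnS leqNgt eH_gt0 orbF => /eqP->.
  by exists (\det N'); rewrite mulr1.
have [a la /(_ e1) aT] := divides_mx_pow_root.
have [k /andP[bk ak]] : exists k : 'I_n, (b <= k)%N && ((invmx U^T *m a) k 0 != 0).
  apply/existsP; apply: contraNT aT => /existsPn a0.
  have xE k : (a^T *m invmx U) 0 k = (invmx U^T *m a) k 0.
    by rewrite -trmx_inv -[a in RHS]trmxK -trmx_mul [RHS]mxE.
  have Ex : a^T *m invmx U = a^T *m invmx U *m (pid_mx b : 'M[F]_n).
    apply/rowP=> k; rewrite [RHS]mxE (bigD1 k) //= big1 => [|j jk].
      rewrite [pid_mx b k k]mxE eqxx addr0; case: ltnP => [|bk]; first by rewrite mulr1.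
      by have := a0 k; rewrite bk negbK xE => /eqP->; rewrite mul0r.
    by rewrite [pid_mx b j k]mxE (negPf (jk : j != k :> nat)) mulr0.
  by rewrite -(mulmxKV Uu a^T) Ex -[_ *m U]mulmxA; apply: submx_trans (submxMl _ _) UT.
apply: (divides_mulC ak).
have -> : ((invmx U^T *m a) k 0)%:MP = (diag_mx d *m C (invmx U^T *m a)) k 0.
  rewrite mul_diag_mx mxE [d 0 k]mxE [map_mx _ _ k 0]mxE.
  by rewrite ltnNge bk mul1r.
(* [N'] sends this column vector to [M *m C a], which [l ^+ e.-1] divides. *)
apply: divides_det_mulmx; rewrite mulmxA -EN -mulmxA -map_mxM mulKVmx //.
by rewrite unitmx_tr.
Qed.

End AlongHyperplane.

(** * The product over all hyperplanes *)

Lemma divides_Q_det (M : 'M[R]_n) :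
  equivariant_mx M -> divides (QtA rG * Qdet rG) (\det M).
Proof.
move=> eqM; rewrite /QtA /Qdet -big_split /=.
under eq_bigr => H _ do rewrite -exprD.
apply: divides_prod_linform => [|H /lform_vecP[]|H H' hH hH'|H hH] //.
- exact: undup_uniq.
(* If one form divides the other they are proportional, so both hyperplanes are the kernel of the
   same form. *)
- have [c0 _] := lform_vecP hH; have [c0' Hc'] := lform_vecP hH'.
  have [_ Hc] := lform_vecP hH.
  case/(divides_linform c0) => a Ea; rewrite (hyperplane_eq hH c0 Hc); symmetry.
  apply: hyperplane_eq hH' c0 _; move: c0' Hc'; rewrite Ea scaler_eq0 negb_or.
  by case/andP=> a0 _ /eqP; rewrite -scalemxAr scaler_eq0 (negPf a0) => /eqP.
exact: divides_det_equivariant.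
Qed.

Lemma Q_neq0 : QtA rG * Qdet rG != 0.
Proof.
have l0 H : H \in hyperplanes rG -> lform H != 0.
  by case/lform_vecP; rewrite -linform_eq0.
rewrite /QtA /Qdet mulf_neq0 // big_seq; apply: (big_ind (fun p => p != 0)) => //.
all: by [apply: oner_neq0 | apply: mulf_neq0 | move=> H /l0; apply: expf_neq0].
Qed.

End Reflections.

(** * Cramer's rule and the basis property *)

Lemma det_neq0_mulmx_eq0 (A : idomainType) n (M : 'M[A]_n) (v : 'rV_n) :
  \det M != 0 -> v *m M = 0 -> v = 0.
Proof.
move=> M0 vM; have : v *m (M *m \adj M) = 0 by rewrite mulmxA vM mul0mx.
rewrite mul_mx_adj mul_mx_scalar => /rowP E; apply/rowP=> i.
by have /eqP := E i; rewrite !mxE mulf_eq0 (negPf M0) => /eqP.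
Qed.

(** Expand along row [i]: its cofactors do not involve that row. *)
Lemma mulmx_adj_row (A : comNzRingType) n (M : 'M[A]_n) (v : 'rV_n) i :
  (v *m \adj M) 0 i = \det (\matrix_(k, j) (if k == i then v 0 j else M k j)).
Proof.
rewrite mxE (expand_det_row _ i); apply: eq_bigr => j _; rewrite !mxE eqxx.
congr (_ * (_ * \det _)); apply/matrixP=> k r.
by rewrite !mxE eq_sym (negPf (neq_lift _ _)).
Qed.

Theorem theorem4p3 (F : fieldType) (gT : finGroupType) (G : {group gT}) (n : nat)
  (rG : mx_representation F G n)
  (hchar : (2 \notin [pchar F])%N)
  (hfaith : mx_faithful rG)
  (hrefl : G \subset <<[set g in G | is_reflection rG g]>>%g)
  (w : 'I_n -> 'rV[{mpoly F[n]}]_n)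
  (hw : forall i, inv_form rG (w i))
  (c : F) (hc : c != 0)
  (hwedge : \det (\matrix_(i, j) w i 0 j) = c%:MP * QtA rG * Qdet rG) :
  (forall om : 'rV[{mpoly F[n]}]_n, inv_form rG om ->
     exists f : 'I_n -> {mpoly F[n]},
       (forall i, inv_poly rG (f i)) /\ om = \sum_(i < n) f i *: w i) /\
  (forall f : 'I_n -> {mpoly F[n]},
     (forall i, inv_poly rG (f i)) -> \sum_(i < n) f i *: w i = 0 ->
     forall i, f i = 0).
Proof.
pose M := \matrix_(i, j) w i 0 j.
have D0 : \det M != 0.
  by rewrite hwedge -mulrA mulf_neq0 ?Q_neq0 // mpolyC_eq0.
have combE f : \sum_(i < n) f i *: w i = \row_i f i *m M.
  apply/rowP=> j; rewrite summxE !mxE; apply: eq_bigr => i _.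
  by rewrite !mxE.
(* The coefficients are arbitrary here, because [indep] is later applied to
   [act_poly rG g (f i) - f i]. *)
have indep f : \sum_(i < n) f i *: w i = 0 -> forall i, f i = 0.
  rewrite combE => /(det_neq0_mulmx_eq0 D0)/rowP f0 i.
  by have := f0 i; rewrite !mxE.
split=> [om inv_om|f _]; last exact: indep.
(* These entries are determinants of [n] invariant forms, and [\det M] is [QtA rG * Qdet rG] up to
   the unit [c]. *)
have /fin_all_exists[f Hf] i : exists q, (om *m \adj M) 0 i = q * \det M.
  have [q Eq] : divides (QtA rG * Qdet rG) ((om *m \adj M) 0 i).
    rewrite mulmx_adj_row.
    have -> : \matrix_(k, j) (if k == i then om 0 j else M k j)
        = \matrix_(k, j) (if k == i then om else w k) 0 j.
      by apply/matrixP=> k j; rewrite !mxE; case: ifP.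
    apply: divides_Q_det; apply: inv_forms_equivariant => k.
    by case: ifP.
  exists (q * c^-1%:MP); rewrite Eq hwedge -[c%:MP * _ * _]mulrA [RHS]mulrA -[q * _ * _]mulrA.
  by rewrite -mpolyCM mulVf // mpolyC1 mulr1.
have Eom : om = \sum_(i < n) f i *: w i.
  have Ef : \det M *: \row_i f i = om *m \adj M.
    by apply/rowP=> i; rewrite Hf !mxE mulrC.
  have E : \det M *: om = \det M *: (\row_i f i *m M).
    by rewrite scalemxAl Ef -mulmxA mul_adj_mx mul_mx_scalar.
  rewrite combE; apply/rowP=> j; apply: (mulfI D0).
  by have /rowP/(_ j) := E; rewrite mxE [RHS]mxE.
(* Applying [g] to the expansion of [om] and cancelling [rG g] gives a second expansion with
   coefficients [act_poly rG g (f i)]; independence identifies the two. *)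
exists f; split=> // i g gG; apply/eqP; rewrite -subr_eq0; apply/eqP.
move: i; apply: indep; rewrite combE.
have Erow : \row_i (act_poly rG g (f i) - f i)
    = map_mx (act_poly rG g) (\row_i f i) - \row_i f i.
  by apply/rowP=> i; rewrite !mxE.
have MG := inv_forms_equivariant hw gG.
have := inv_form_map gG (inv_om g gG).
rewrite Eom combE map_act_mulmx MG !mulmxA.
move/(congr1 (mulmxr (map_mx (@mpolyC n F) (invmx (rG g))))).
rewrite /= -!mulmxA -map_mxM mulmxV ?repr_mx_unit // map_mx1 !mulmx1 => E.
by rewrite Erow mulmxBl E subrr.
Qed.
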